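(* Let $n$ be a nonnegative integer and let $B_n$ be the set of bipartite graphs on the vertex set $\{1,2,\ldots,n\}$ with basis an initial segment. For $U=(X_1,X_2,E(U))$ and $V=(Y_1,Y_2,E(V))$ in $B_n$, define $$U\leq V \iff |X_1|\leq |Y_1| \ \text{ and } \ \{(i,j)\in E(U) \mid j>|Y_1|\}=\{(i,j)\in E(V)\mid i\leq |X_1|\}.$$ Then $\leq$ is a partial order on $B_n$.
   Context: An element of $B_n$ is a bipartite graph $U=(X_1,X_2,E(U))$ with vertex set $\{1,\ldots,n\}$, where $X_1=\{1,2,\ldots,k\}$ for some $0\leq k\leq n$ (called the basis of $U$; it is empty if $k=0$), $X_2=\{k+1,\ldots,n\}$, and the edge set $E(U)$ is an arbitrary subset of $X_1\times X_2$; an edge joining $i\in X_1$ and $j\in X_2$ is written $(i,j)$, so $(i,j)\in E(U)$ implies $i<j$. The basis is part of the data: two elements of $B_n$ with the same edge set but different bases are distinct. *)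

(* Defs.v *)
From mathcomp Require Import all_boot.

Set Implicit Arguments.
Unset Strict Implicit.
Unset Printing Implicit Defensive.

(* The vertex set {1, ..., n} is carried by 'I_n, whose values are
   0, ..., n.-1: the ordinal v stands for the vertex numbered v.+1. *)
Definition label (n : nat) (v : 'I_n) : nat := v.+1.

Definition initial (n k : nat) : {set 'I_n} := [set v | label v <= k].

(* The basis {1, ..., k}, 0 <= k <= n, is recorded by its size k, so graphs with the
   same edges but different bases are distinct. *)
Record B (n : nat) : Type := MkB {
  basis_size : 'I_n.+1;
  edges : {set 'I_n * 'I_n};
  edges_bipartite :
    edges \subset setX (initial n basis_size) (~: initial n basis_size)
}.

Definition basis (n : nat) (U : B n) : {set 'I_n} := initial n (basis_size U).

Definition leB (n : nat) : rel (B n) := fun U V =>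
  (#|basis U| <= #|basis V|) &&
  ([set e in edges U | label e.2 > #|basis V|]
     == [set e in edges V | label e.1 <= #|basis U|]).

(* Main.v *)
Require Import Defs.
From mathcomp Require Import all_boot.

(** Everything rests on [edge_bounds]: an edge (i,j) of U satisfies i <= |X_1| < j. For U against
    itself both filters therefore keep every edge, which gives reflexivity. If U <= V <= U, the
    bases have equal size, so again both filters keep everything and the edge sets agree. For U <= V
    <= W, an edge is carried from U to W, or back, through V: the monotone basis sizes ensure that
    it passes the filter at each stage. *)

Lemma card_initial (n k : nat) : k <= n -> #|initial n k| = k.
Proof.
move=> le_kn; rewrite cardsE -sum1_card.
(* [label i <= k] computes to [i < k], so the sum over ['I_n] shrinks to one over ['I_k]. *)
rewrite (eq_bigl (fun i : 'I_n => i < k)) // -(big_ord_widen n (fun=> 1)) //.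
by rewrite sum1_card card_ord.
Qed.

Lemma card_basis (n : nat) (U : B n) : #|basis U| = basis_size U.
Proof. by rewrite card_initial // -ltnS. Qed.

Lemma edge_bounds (n : nat) (U : B n) (e : 'I_n * 'I_n) :
  e \in edges U -> label e.1 <= #|basis U| < label e.2.
Proof.
move/(subsetP (edges_bipartite U)); rewrite card_basis !inE.
by rewrite -ltnNge.
Qed.

Lemma leBP (n : nat) (U V : B n) :
  reflect (#|basis U| <= #|basis V| /\
           forall e, (e \in edges U) && (#|basis V| < label e.2)
                     = (e \in edges V) && (label e.1 <= #|basis U|))
          (leB U V).
Proof.
apply: (iffP andP) => -[le_UV eqE]; split=> //.
  by move=> e; move/eqP/setP/(_ e): eqE; rewrite !inE.
by apply/eqP/setP => e; rewrite !inE.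
Qed.

(** The remaining field is a boolean equality, hence proof-irrelevant. *)
Lemma B_inj (n : nat) (U V : B n) :
  basis_size U = basis_size V -> edges U = edges V -> U = V.
Proof.
case: U V => [k E bE] [l F bF] /= eq_kl eq_EF.
rewrite -{}eq_kl -{}eq_EF in bF *.
by rewrite (bool_irrelevance bE bF).
Qed.

Lemma leB_refl (n : nat) : reflexive (@leB n).
Proof.
move=> U; apply/leBP; split=> // e.
by case: (boolP (e \in edges U)) => // /edge_bounds/andP[-> ->].
Qed.

Lemma leB_anti (n : nat) : antisymmetric (@leB n).
Proof.
move=> U V /andP[/leBP[le_UV eqE] /leBP[le_VU _]].
have eq_UV : #|basis U| = #|basis V| by apply/eqP; rewrite eqn_leq le_UV.
apply: B_inj; first by apply: val_inj; rewrite /= -!card_basis.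
(* The two thresholds in [eqE] now coincide, so an edge of either graph passes its filter by
   [edge_bounds]. *)
apply/setP => e; apply/idP/idP => eE; have /andP[le1 lt2] := edge_bounds _ _ _ eE.
  by move: (eqE e); rewrite eE -eq_UV lt2 => /esym/andP[].
by move: (eqE e); rewrite eE eq_UV le1 => /andP[].
Qed.

Lemma leB_trans (n : nat) : transitive (@leB n).
Proof.
move=> V U W /leBP[le_UV eqUV] /leBP[le_VW eqVW].
apply/leBP; split=> [|e]; first exact: leq_trans le_UV le_VW.
apply/andP/andP => -[].
  move=> eU lt_W.
  (* The edge ends beyond the basis of W, hence beyond that of V, so [eqUV] puts it in V. *)
  have /andP[eV le_U] : (e \in edges V) && (label e.1 <= #|basis U|).
    by rewrite -eqUV eU (leq_ltn_trans le_VW lt_W).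
  by move: (eqVW e); rewrite eV lt_W => /esym/andP[].
move=> eW le_U.
(* Dually, the edge starts in the basis of U, hence in that of V, so [eqVW] puts it in V. *)
have /andP[eV lt_W] : (e \in edges V) && (#|basis W| < label e.2).
  by rewrite eqVW eW (leq_trans le_U le_UV).
by move: (eqUV e); rewrite eV le_U => /andP[].
Qed.

Theorem proposition1 (n : nat) :
  [/\ reflexive (@leB n), antisymmetric (@leB n) & transitive (@leB n)].
Proof. by split; [exact: leB_refl | exact: leB_anti | exact: leB_trans]. Qed.
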